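(* Let $(\mathcal{X},\mathcal{F},\sigma)$ be a probability space with an $\alpha$-homogeneous atomic filtration, $0<\alpha\le1/2$, and let $f\in L^1(\mathcal{X})$ satisfy $\|S(f)\|_\infty<\infty$. Then \[ \mathbb{E}\exp(f-\mathbb{E}f)\le e^{\|S(f)\|_\infty^2/(4\alpha)}. \]
   Context: An atomic filtration on a probability space $(\mathcal{X},\mathcal{F},\sigma)$ is an increasing sequence of $\sigma$-algebras $\mathcal{F}_n\subset\mathcal{F}$, $n\ge0$, with $\mathcal{F}_0=\{\varnothing,\mathcal{X}\}$, $\mathcal{F}$ generated by the $\mathcal{F}_n$, and such that for each $n$ there is a countable collection $\mathcal{D}_n$ of disjoint sets (''cubes'') with every set of $\mathcal{F}_n$ a union of sets of $\mathcal{D}_n$. Write $\mathcal{D}=\bigcup_n\mathcal{D}_n$, $|A|=\sigma(A)$, and for $Q\in\mathcal{D}_n$ let $\operatorname{ch}Q=\{R\in\mathcal{D}_{n+1}:R\subset Q\}$. The filtration is $\alpha$-homogeneous if $|Q'|\ge\alpha|Q|$ for every cube $Q$ and every $Q'\in\operatorname{ch}Q$. For $|A|>0$, $\langle f\rangle_A=|A|^{-1}\int_A f$; $\mathbb{E}f=\langle f\rangle_{\mathcal{X}}$. Let $\mathbf{E}_Q f=\langle f\rangle_Q\mathbf{1}_Q$, $\Delta_Q=\sum_{R\in\operatorname{ch}Q}\mathbf{E}_R-\mathbf{E}_Q$, and $S f=\bigl(\sum_{Q\in\mathcal{D}}|\Delta_Q f|^2\bigr)^{1/2}$. *)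

(* Defs.v *)
From HB Require Import structures.
From mathcomp Require Import all_boot all_order all_algebra.
From mathcomp Require Import all_classical all_reals all_analysis.
From mathcomp Require Import ess_sup_inf.
Set Implicit Arguments. Unset Strict Implicit. Unset Printing Implicit Defensive.
Import Order.TTheory GRing.Theory Num.Theory.
Import numFieldNormedType.Exports.
Local Open Scope classical_set_scope.
Local Open Scope ring_scope.

Section atomic.
Context (d : measure_display) (T : measurableType d) (R : realType).

Definition atomic_filtration (F : nat -> set (set T)) (D : nat -> set (set T)) :=
  (forall n, sigma_algebra setT (F n)) /\
  (forall n, F n `<=` measurable) /\
  (forall n, F n `<=` F n.+1) /\
  F 0%N = [set set0; setT] /\
  (@measurable d T) = <<s \bigcup_n F n >> /\
  (forall n, [/\ countable (D n), trivIset (D n) id, D n `<=` F n &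
     (forall A, F n A -> exists2 C, C `<=` D n & A = \bigcup_(Q in C) Q)]).

Definition ch (D : nat -> set (set T)) (n : nat) (Q : set T) : set (set T) :=
  [set R | D n.+1 R /\ R `<=` Q].

Definition homogeneous (P : probability T R) (D : nat -> set (set T)) (alpha : R) :=
  forall n Q R', D n Q -> ch D n Q R' -> (alpha%:E * P Q <= P R')%E.

Definition avg (P : probability T R) (A : set T) (f : T -> R) : R :=
  fine (\int[P]_(x in A) (f x)%:E) / fine (P A).

Definition EQ (P : probability T R) (Q : set T) (f : T -> R) : T -> R :=
  fun x => (avg P Q f) * (\1_Q x).

Definition DeltaQ (P : probability T R) (D : nat -> set (set T)) (n : nat)
  (Q : set T) (f : T -> R) : T -> R :=
  fun x => (\sum_(R' \in ch D n Q) EQ P R' f x) - EQ P Q f x.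

Definition Sfun (P : probability T R) (D : nat -> set (set T)) (f : T -> R)
  : T -> \bar R :=
  fun x => sqrte (\esum_(p in [set p : nat * set T | D p.1 p.2])
                   ((DeltaQ P D p.1 p.2 f x) ^+ 2)%:E).

End atomic.

(* Main.v *)
(* Completing the square, the one-step estimate
   [\sum_i p_i expR (x_i - x_i^2 / (4 alpha)) <= 1] for a centred variable whose
   atoms have mass at least [alpha] reads
   [\sum_i p_i expR (- alpha u_i^2) <= expR (- alpha)] with [\sum_i p_i u_i = 1].
   The Gaussian lies below its tangents up to [u = 1 / (2 alpha)], and at most one
   [u_i] can exceed this value, which reduces the estimate to two atoms; there a
   maximum is a critical point, where the value is explicit.  With [f_n] the
   averages of [f] over the cubes of generation [n] and [S_n^2] the partial sums
   of the square function, [expR (f_n - S_n^2 / (4 alpha))] is therefore a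
   supermartingale, which bounds the exponential moments of [f_n].  Finally
   [f_n] is arbitrarily close to [f] in [L^1], and by convexity of [expR]
   [expR (min (f - Ef) N) <= expR (f_n - Ef) + expR N * `|f_n - f|]. *)

Require Import Defs.
From HB Require Import structures.
From mathcomp Require Import all_boot all_order all_algebra.
From mathcomp Require Import finmap.
From mathcomp Require Import all_classical all_reals all_analysis.
From mathcomp Require Import ess_sup_inf measurable_realfun ring lra.
Import Order.TTheory GRing.Theory Num.Theory.
Import numFieldNormedType.Exports.
Local Open Scope classical_set_scope.
Local Open Scope ring_scope.

(** * Scalar inequalities: exponentials, Gaussian tangents, two atoms *)

Section scalar_inequalities.
Context {R : realType}.
Implicit Types (a h m p q t u x z : R).

Lemma le_of_derive_ge0 (f df : R -> R) x :
  (forall y : R, is_derive y 1 f (df y)) -> (forall y, 0 <= y -> 0 <= df y) ->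
  0 <= x -> f 0 <= f x.
Proof.
move=> fdf df0 x0.
have cf : {within `[0, x], continuous f}.
  apply: derivable_within_continuous => y _; exact: ex_derive.
have [c] := MVT_segment x0 (fun y _ => fdf y) cf.
rewrite in_itv/= => /andP[c0 _] H.
by rewrite -subr_ge0 H subr0 mulr_ge0// df0.
Qed.

(** Amounts to [tanh (h / 2) <= h / 2]; at [h = ln (1 + z)] it becomes the lower bound [ln1D_ge]. *)
Lemma two_expR_sub1_le h : 0 <= h -> 2 * (expR h - 1) <= h * (expR h + 1).
Proof.
move=> h0.
pose f x := x * (expR x + 1) - 2 * (expR x - 1).
suff : f 0 <= f h by rewrite /f expR0; lra.
apply: (@le_of_derive_ge0 f (fun x => 1 + (x - 1) * expR x)) => // [y|y y0].
  by rewrite /f; apply: is_derive_eq; rewrite /GRing.scale/=; ring.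
have := expR_ge1Dx (- y); rewrite expRN => H.
have e0 := expR_gt0 y.
have : (1 - y) * expR y <= 1.
  by rewrite -ler_pdivlMr// mul1r; lra.
by lra.
Qed.

(** Amounts to [h <= sinh h]; it is applied at [h = - ln (1 - z)]. *)
Lemma two_mul_expR_le h : 0 <= h -> 2 * h * expR h <= expR h ^+ 2 - 1.
Proof.
move=> h0.
pose f x := expR x ^+ 2 - 2 * x * expR x.
suff : f 0 <= f h by rewrite /f expR0; lra.
apply: (@le_of_derive_ge0 f (fun x => 2 * expR x * (expR x - (1 + x)))) => // [y|y y0].
  by rewrite /f; apply: is_derive_eq; rewrite /GRing.scale/=; ring.
by rewrite !mulr_ge0 ?expR_ge0// subr_ge0 expR_ge1Dx.
Qed.

Lemma ln1D_ge z : 0 <= z -> 2 * z / (2 + z) <= ln (1 + z).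
Proof.
move=> z0; have h0 : 0 <= ln (1 + z) by rewrite ln_ge0//; lra.
have := two_expR_sub1_le _ h0; rewrite lnK ?posrE; last lra.
by move=> H; rewrite ler_pdivrMr; lra.
Qed.

Lemma expR_sub_sqr_le1D z : 0 <= z -> expR (z - z ^+ 2 / 2) <= 1 + z.
Proof.
move=> z0; have z1 : 0 < 1 + z by lra.
rewrite -[leRHS]lnK ?posrE// ler_expR; apply: le_trans (ln1D_ge _ z0).
rewrite ler_pdivlMr; last lra.
have : 0 <= z ^+ 3 by exact: exprn_ge0.
by lra.
Qed.

Lemma expR_sub_sqr_le1B z : 0 <= z < 1 ->
  expR (- z - z ^+ 2 / (2 * (1 - z))) <= 1 - z.
Proof.
move=> /andP[z0 z1]; have z1' : 0 < 1 - z by lra.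
have h0 : 0 <= - ln (1 - z) by rewrite oppr_ge0 ln_le0//; lra.
have := two_mul_expR_le _ h0; rewrite expRN lnK ?posrE// => H.
rewrite -[leRHS]lnK ?posrE// ler_expR.
(* The exponent is [- sinh h] for [h = - ln (1 - z)]. *)
have -> : - z - z ^+ 2 / (2 * (1 - z)) = - ((1 - (1 - z) ^+ 2) / (2 * (1 - z))).
  by field; lra.
rewrite lerNl ler_pdivlMr; last lra.
have := ler_pM2r (exprn_gt0 2 z1') => /(_ _ _).
move=> K; rewrite -K in H.
move: H; rewrite mulrBl mul1r expr2 !mulrA divfK ?gt_eqF// -!expr2.
have -> : (1 - z)^-1 ^+ 2 * (1 - z) * (1 - z) = 1 by field; lra.
by lra.
Qed.

(** With [z = 2 a m (u - m)] the claim is [expR (- z - a (u - m)^2) <= 1 - z], where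
    [z^2 = 4 a m^2 * (a (u - m)^2)]. For [z >= 0], [expR_sub_sqr_le1B] suffices once
    [2 a m^2 <= 1 - z], that is [2 a m u <= 1]. For [z < 0], [expR_sub_sqr_le1D] at [- z] suffices
    because [2 a m^2 <= 1]. *)
Lemma gauss_le_tangent a m u : 0 < a -> a <= 2^-1 -> 0 <= m <= 1 ->
  2 * a * u <= 1 ->
  expR (- (a * u ^+ 2)) <= expR (- (a * m ^+ 2)) * (1 - 2 * a * m * (u - m)).
Proof.
move=> a0 a2 /andP[m0 m1] ua.
pose z := 2 * a * m * (u - m).
have -> : - (a * u ^+ 2) = - (a * m ^+ 2) + (- z - a * (u - m) ^+ 2).
  by rewrite /z; ring.
rewrite expRD ler_pM2l ?expR_gt0//.
change (expR (- z - a * (u - m) ^+ 2) <= 1 - z).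
have m2 : m ^+ 2 <= 1 by rewrite expr_le1.
have d0 : 0 <= a * (u - m) ^+ 2 by rewrite mulr_ge0 ?sqr_ge0// ltW.
have zE : z ^+ 2 = 2 * (2 * a * m ^+ 2) * (a * (u - m) ^+ 2) by rewrite /z; ring.
have am0 : 0 <= a * m ^+ 2 by rewrite mulr_ge0 ?sqr_ge0// ltW.
have [z0|z0] := leP 0 z.
- have z1 : 2 * a * m ^+ 2 <= 1 - z.
    have : 2 * a * u * m <= 1 * m by rewrite ler_wpM2r.
    by rewrite /z; lra.
  have z1' : 0 < 1 - z.
    (* At [m = 0] the bound [z1] does not give strict positivity, but there [z = 0]. *)
    move: m0; rewrite le_eqVlt => /predU1P[m0|m0].
      by rewrite /z -m0; lra.
    apply: lt_le_trans z1; rewrite !mulr_gt0// exprn_gt0//.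
  apply: le_trans (expR_sub_sqr_le1B z _); last by rewrite z0/=; lra.
  rewrite ler_expR lerD2l lerN2 ler_pdivrMr; last lra.
  by rewrite zE mulrC ler_wpM2l//; lra.
- apply: le_trans (expR_sub_sqr_le1D (- z) _); last lra.
  rewrite ler_expR lerD2l lerN2 ler_pdivrMr// sqrrN zE.
  rewrite mulrC ler_wpM2l//.
  have : a * m ^+ 2 <= 2^-1 * 1 by rewrite ler_pM// ?sqr_ge0// ltW.
  by lra.
Qed.

(* At a critical point of the left-hand side of [two_point_gauss],
   [u * expR (- a u^2) = m * expR (- a m^2)], so its value there is explicit in [m]. *)
Lemma two_point_critical a p m : 0 < a -> a <= 2^-1 -> a <= p -> p <= 1 ->
  0 < m <= 1 ->
  expR (- (a * m ^+ 2)) * ((1 - p) - (1 - 2 * p) * m) <=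
  expR (- a) * (1 - (1 - p) * m).
Proof.
move=> a0 a2 ap p1 /andP[m0 m1].
have p0 : 0 < p by lra.
pose t := 1 - m.
have t0 : 0 <= t by rewrite /t; lra.
have t1 : t < 1 by rewrite /t; lra.
have mE : m = 1 - t by rewrite /t; ring.
have den : 0 < p + (1 - 2 * p) * t.
  have [?|?] := leP p 2^-1.
    by rewrite ltr_pwDl// mulr_ge0//; lra.
  have : (2 * p - 1) * t < (2 * p - 1) * 1 by rewrite ltr_pM2l; lra.
  by lra.
(* [1 + z] is the quotient of the two linear factors of the claim, which thus reads
   [a (1 - m^2) <= ln (1 + z)], with [1 - m^2 = 2 t - t^2]. *)
pose z := p * t / (p + (1 - 2 * p) * t).
have z0 : 0 <= z by rewrite /z divr_ge0// ?mulr_ge0//; lra.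
have pt0 : 0 <= p * t by rewrite mulr_ge0//; lra.
have H : a * (2 * t - t ^+ 2) <= 2 * z / (2 + z).
  have den2 : 0 < 2 * p + (2 - 3 * p) * t by lra.
  have -> : 2 * z / (2 + z) = 2 * p * t / (2 * p + (2 - 3 * p) * t).
    by rewrite /z; field; apply/andP; split; lra.
  rewrite ler_pdivlMr//.
  have -> : a * (2 * t - t ^+ 2) * (2 * p + (2 - 3 * p) * t) =
    t * (a * ((2 - t) * (2 * p + (2 - 3 * p) * t))) by ring.
  rewrite [leRHS]mulrC ler_wpM2l//.
  have c0 : 0 <= (2 - t) * (2 * p + (2 - 3 * p) * t).
    by rewrite mulr_ge0//; lra.
  (* Since [a <= p] and [a <= 1/2], [a] is replaced by the smaller of the two bounds, which leaves a
     polynomial inequality in [p] and [t]. *)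
  have [pl|pl] := leP p 2^-1.
    apply: (@le_trans _ _ (p * ((2 - t) * (2 * p + (2 - 3 * p) * t)))).
      by rewrite ler_wpM2r.
    rewrite mulrC ler_pM2r//.
    have : 0 <= 2 * (1 - 2 * p) * (1 - t) ^+ 2.
      by rewrite mulr_ge0 ?sqr_ge0//; lra.
    have : 0 <= p * t ^+ 2 by rewrite mulr_ge0 ?sqr_ge0//; lra.
    by lra.
  apply: (@le_trans _ _ (2^-1 * ((2 - t) * (2 * p + (2 - 3 * p) * t)))).
    by rewrite ler_wpM2r.
  have : 0 <= t * ((8 * p - 4) + (2 - 3 * p) * t).
    rewrite mulr_ge0//.
    have : 0 <= (8 * p - 4) * (1 - t) by rewrite mulr_ge0//; lra.
    by lra.
  by lra.
have {}H := le_trans H (ln1D_ge _ z0).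
have z1 : 1 + z = (1 - (1 - p) * m) / ((1 - p) - (1 - 2 * p) * m).
  by rewrite /z mE; field; lra.
have d0 : 0 < (1 - p) - (1 - 2 * p) * m by rewrite mE; lra.
rewrite -ler_pdivlMr// -mulrA -z1.
have -> : - (a * m ^+ 2) = - a + a * (2 * t - t ^+ 2) by rewrite mE; ring.
rewrite expRD ler_pM2l ?expR_gt0//.
by rewrite -[leRHS]lnK ?posrE ?ler_expR//; lra.
Qed.

(** The points [1 + (1 - p) s] and [1 - p s], with masses [p] and [1 - p], have mean 1. The
    left-hand side attains a maximum over [[0, 2 / p]]: at [0] there is equality, at [2 / p] the
    bound is direct, and an interior maximum is critical, which [two_point_critical] handles. *)
Lemma two_point_gauss a p s : 0 < a -> a <= 2^-1 -> a <= p -> p <= 1 ->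
  0 <= s <= 2 / p ->
  p * expR (- (a * (1 + (1 - p) * s) ^+ 2)) +
  (1 - p) * expR (- (a * (1 - p * s) ^+ 2)) <= expR (- a).
Proof.
move=> a0 a2 ap p1 s0.
have p0 : 0 < p by lra.
pose q := 1 - p.
pose F x := p * expR (- (a * (1 + q * x) ^+ 2)) +
            q * expR (- (a * (1 - p * x) ^+ 2)).
pose dF x := 2 * a * p * q * ((1 - p * x) * expR (- (a * (1 - p * x) ^+ 2))
   - (1 + q * x) * expR (- (a * (1 + q * x) ^+ 2))).
have FdF x : is_derive x 1 F (dF x).
  rewrite /F /dF; apply: is_derive_eq; rewrite /GRing.scale/=; ring.
have q0 : 0 <= q by rewrite /q; lra.
have b0 : 0 <= 2 / p by rewrite divr_ge0// ltW.
have cF : {within `[0, 2 / p], continuous F}.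
  by apply: derivable_within_continuous => y _; exact: ex_derive.
have [c cI cmax] := EVT_max b0 cF.
apply: (le_trans (cmax s _)); first by rewrite in_itv.
move: cI; rewrite in_itv/= => /andP[c0 c2].
move: (c0); rewrite le_eqVlt => /predU1P[<-|{}c0].
  by rewrite /F !mulr0 addr0 subr0 expr1n mulr1 /q; lra.
(* At [2 / p] the second point is [-1], with the same Gaussian value as [1], while the first is at
   least [1]. *)
move: (c2); rewrite le_eqVlt => /predU1P[->|{}c2].
  rewrite /F (_ : 1 - p * (2 / p) = -1) ?sqrrN; last by field; lra.
  rewrite expr1n mulr1.
  rewrite [leRHS](_ : _ = p * expR (- a) + q * expR (- a)); last by rewrite /q; ring.
  rewrite lerD2r ler_pM2l// ler_expR lerN2 ler_peMr//; first exact: ltW.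
  rewrite exprn_ege1// lerDl mulr_ge0//.
have cI : c \in `]0, 2 / p[%R by rewrite in_itv/= c0 c2.
have Fc : is_derive c 1 F 0.
  apply: (derive1_at_max b0 _ cI) => [y _|y yI]; first exact: ex_derive.
  by apply: cmax; apply: subset_itv_oo_cc.
have [q00|qn0] := eqVneq q 0.
  rewrite /F q00 !mul0r !addr0 expr1n mulr1.
  by rewrite (_ : p = 1) ?mul1r//; move: q00; rewrite /q; lra.
have qp : 0 < q by rewrite lt_neqAle eq_sym qn0.
have dFc : dF c = 0.
  have [_ <-] := FdF c; by have [_ ->] := Fc.
pose m := 1 - p * c.
have u0 : 0 < 1 + q * c by rewrite ltr_pwDl// mulr_ge0// ltW.
have crit : m * expR (- (a * m ^+ 2)) =
    (1 + q * c) * expR (- (a * (1 + q * c) ^+ 2)).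
  apply/eqP; rewrite -subr_eq0; move/eqP: dFc; rewrite /dF.
  have k0 : 0 < 2 * a * p * q by rewrite !mulr_gt0.
  by rewrite mulf_eq0 (gt_eqF k0).
have m0 : 0 < m.
  rewrite -(@pmulr_lgt0 _ (expR (- (a * m ^+ 2)))) ?expR_gt0//.
  by rewrite crit mulr_gt0 ?expR_gt0.
have m1 : m <= 1 by rewrite /m lerBlDr lerDl mulr_ge0 ?ltW.
(* Multiplying by [1 + q * c] and by [p] lets [crit] and the mean constraint [uE] eliminate the
   first point in favour of [m]. *)
rewrite -(ler_pM2r u0).
have uE : p * (1 + q * c) = 1 - q * m by rewrite /m /q; ring.
have -> : F c * (1 + q * c) =
    expR (- (a * m ^+ 2)) * (q * (1 + q * c) + p * m).
  rewrite /F -/m (_ : _ * _ = p * ((1 + q * c) *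
    expR (- (a * (1 + q * c) ^+ 2))) + q * expR (- (a * m ^+ 2)) * (1 + q * c)).
    by rewrite -crit; ring.
  by ring.
rewrite -(ler_pM2l p0).
rewrite [leRHS](_ : _ = expR (- a) * (1 - q * m)); last by rewrite -uE; ring.
rewrite [leLHS](_ : _ = expR (- (a * m ^+ 2)) *
    ((1 - p) - (1 - 2 * p) * m)); last by rewrite /m /q; ring.
by apply: two_point_critical => //; rewrite m0.
Qed.
End scalar_inequalities.

(** * The one-step estimate for finitely many atoms of mass at least [a] *)

Section homogeneous_sums.
Context {R : realType}.

(** The sum of the tangent bounds depends only on the total mass and the first moment; the linear
    part vanishes when [m] is the mean. *)
Lemma sum_tangent (I : eqType) (r : seq I) (Q : pred I) (p u : I -> R) (A k m : R) :
  \sum_(i <- r | Q i) p i * (A * (1 - k * (u i - m))) =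
  A * (\sum_(i <- r | Q i) p i -
       k * (\sum_(i <- r | Q i) p i * u i - m * \sum_(i <- r | Q i) p i)).
Proof.
rewrite (eq_bigr (fun i => (A * (1 + k * m)) * p i - (A * k) * (p i * u i))).
  by rewrite big_split/= sumrN -!mulr_sumr; ring.
by move=> i _; ring.
Qed.

(** If every [u i] is at most [1 / (2 a)], the tangent at the mean 1 suffices. Otherwise one atom
    [i0] is kept, the others are bounded by the tangent at their own mean [m], and [two_point_gauss]
    concludes. *)
Lemma sum_gauss_le_ge0 (I : eqType) (r : seq I) (p u : I -> R) (a : R) :
  uniq r -> 0 < a -> a <= 2^-1 -> (forall i, i \in r -> a <= p i) ->
  (forall i, 0 <= u i) ->
  \sum_(i <- r) p i = 1 -> \sum_(i <- r) p i * u i = 1 ->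
  \sum_(i <- r) p i * expR (- (a * u i ^+ 2)) <= expR (- a).
Proof.
move=> ur a0 a2 ap u0 p1 pu1.
have p0 i : i \in r -> 0 <= p i by move=> /ap; apply: le_trans; exact: ltW.
have [/allP all_small|/allPn[i0 i0r]] := boolP (all (fun i => 2 * a * u i <= 1) r).
  apply: (@le_trans _ _ (\sum_(i <- r) p i *
      (expR (- (a * 1 ^+ 2)) * (1 - 2 * a * 1 * (u i - 1))))).
    rewrite big_seq [leRHS]big_seq; apply: ler_sum => i ir.
    by rewrite ler_wpM2l ?p0// gauss_le_tangent ?lexx ?ler01//; exact: all_small.
  by rewrite sum_tangent p1 pu1 expr1n !mulr1 subrr mulr0 subr0 mulr1.
rewrite -ltNge => big.
set P := p i0; set U := u i0 in big.
move: p1 pu1; rewrite !(bigD1_seq i0 i0r ur)/= -/P -/U.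
set S := (X in P + X = 1 -> _); set SU := (X in _ -> _ * _ + X = 1 -> _).
move=> p1 pu1.
have SU0 : 0 <= SU.
  rewrite /SU big_seq_cond sumr_ge0// => i /andP[ir _].
  by rewrite mulr_ge0// p0.
have aP : a <= P by exact: ap.
have U0 : 0 <= U by exact: u0.
have U1 : 1 < U.
  rewrite ltNge; apply/negP => U1.
  have : 2 * a * U <= 1 * 1 by rewrite ler_pM//; lra.
  by lra.
have q0 : 0 < 1 - P.
  rewrite subr_gt0 ltNge; apply/negP => P1.
  have : 1 * 1 < P * U.
    by apply: (@lt_le_trans _ _ (1 * U)); [lra|rewrite ler_wpM2r//; lra].
  by lra.
have aU : a * U <= P * U by rewrite ler_wpM2r//; lra.
(* Parametrization of [two_point_gauss]: [U = 1 + (1 - P) s], and [m = 1 - P s] is the mean of the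
   other atoms. Then [m >= 0] gives [P * s <= 1], well within [s <= 2 / P]. *)
pose s := (U - 1) / (1 - P).
pose m := 1 - P * s.
have UE : U = 1 + (1 - P) * s by rewrite /s; field; lra.
have mE : (1 - P) * m = SU.
  by rewrite /m /s (_ : SU = 1 - P * U); [field; lra|lra].
have m0 : 0 <= m by rewrite -(@pmulr_rge0 _ (1 - P))// mE.
have s0 : 0 <= s by rewrite /s divr_ge0//; lra.
have m1 : m <= 1 by rewrite /m lerBlDr lerDl mulr_ge0//; lra.
apply: le_trans (@two_point_gauss _ a P s a0 a2 aP _ _); last 2 first.
- by lra.
- by rewrite s0/= ler_pdivlMr; move: m0; rewrite /m; lra.
rewrite -UE lerD2l -/m.
apply: (@le_trans _ _ (\sum_(i <- r | i != i0) p i *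
      (expR (- (a * m ^+ 2)) * (1 - 2 * a * m * (u i - m))))).
  rewrite big_seq_cond [leRHS]big_seq_cond; apply: ler_sum => i /andP[ir ii0].
  rewrite ler_wpM2l ?p0// gauss_le_tangent// ?m0//.
  (* As [P * U >= a * U > 1/2], the first moment [SU] of the other atoms is below [1/2], hence so is
     each [a * u i]. *)
  have : p i * u i <= SU.
    rewrite /SU -big_filter (bigD1_seq i)/= ?filter_uniq//; last first.
      by rewrite mem_filter ii0.
    rewrite lerDl big_filter_cond big_seq_cond sumr_ge0// => j /andP[jr _].
    by rewrite mulr_ge0// p0.
  have : a * u i <= p i * u i by rewrite ler_wpM2r// ap.
  by lra.
rewrite sum_tangent -/S -/SU -mE (_ : S = 1 - P); last by lra.
by rewrite [m * _]mulrC subrr mulr0 subr0 mulrC.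
Qed.

(** Passing to [|u i| / M] with [M] the mean of [|u i|] restores nonnegativity and mean 1. Since
    [M >= 1] the squares decrease, so the Gaussian sum can only grow. *)
Lemma sum_gauss_le (I : eqType) (r : seq I) (p u : I -> R) (a : R) :
  uniq r -> 0 < a -> a <= 2^-1 -> (forall i, i \in r -> a <= p i) ->
  \sum_(i <- r) p i = 1 -> \sum_(i <- r) p i * u i = 1 ->
  \sum_(i <- r) p i * expR (- (a * u i ^+ 2)) <= expR (- a).
Proof.
move=> ur a0 a2 ap p1 pu1.
have p0 i : i \in r -> 0 <= p i by move=> /ap; apply: le_trans; exact: ltW.
pose M := \sum_(i <- r) p i * `|u i|.
have M1 : 1 <= M.
  rewrite -pu1 /M big_seq [leRHS]big_seq; apply: ler_sum => i ir.
  by rewrite ler_wpM2l ?p0// ler_norm.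
have Mp : 0 < M by lra.
apply: le_trans (@sum_gauss_le_ge0 _ r p (fun i => `|u i| / M) a ur a0 a2 ap _ p1 _).
- rewrite big_seq [leRHS]big_seq; apply: ler_sum => i ir.
  rewrite ler_wpM2l ?p0// ler_expR lerN2 ler_wpM2l ?(ltW a0)//.
  rewrite exprMn -[leRHS]mulr1 real_normK ?num_real// ler_wpM2l ?sqr_ge0//.
  by rewrite exprn_ile1// ?invr_ge0 ?invf_le1// ltW.
- by move=> i; rewrite divr_ge0// ltW.
- rewrite (eq_bigr (fun i => p i * `|u i| / M)); last by move=> i _; rewrite mulrA.
  by rewrite -mulr_suml divff// gt_eqF.
Qed.

(* Completing the square, [x - x^2 / (4 a) = a - a u^2] with [x = 2 a (1 - u)]. *)
Lemma sum_expR_sub_sqr_le1 (I : eqType) (r : seq I) (p x : I -> R) (a : R) :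
  uniq r -> 0 < a -> a <= 2^-1 -> (forall i, i \in r -> a <= p i) ->
  \sum_(i <- r) p i = 1 -> \sum_(i <- r) p i * x i = 0 ->
  \sum_(i <- r) p i * expR (x i - x i ^+ 2 / (4 * a)) <= 1.
Proof.
move=> ur a0 a2 ap p1 px0.
pose u i := 1 - x i / (2 * a).
have := @sum_gauss_le _ r p u a ur a0 a2 ap p1.
rewrite (eq_bigr (fun i => p i - p i * x i / (2 * a))); last first.
  by move=> i _; rewrite /u; ring.
rewrite big_split/= sumrN -mulr_suml px0 mul0r subr0 => /(_ p1) H.
rewrite (eq_bigr (fun i => expR a * (p i * expR (- (a * u i ^+ 2))))).
  by rewrite -mulr_sumr mulrC -ler_pdivlMr ?expR_gt0// mul1r -expRN.
move=> i _; rewrite mulrCA -expRD; congr (_ * expR _).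
by rewrite /u; field; lra.
Qed.
End homogeneous_sums.

(** * Integrals and measures over finite partitions *)

Section partition_integral.
Context {d : measure_display} {T : measurableType d} {R : realType}.
Context (mu : {measure set T -> \bar R}).

(** Turns a collection of measurable sets into a family indexed by all sets and measurable at every
    index, the form taken by the finite-union lemmas. *)
Let mset (Q : set T) : set T := if `[< measurable Q >] then Q else set0.

Let mset_measurable Q : measurable (mset Q).
Proof. by rewrite /mset; case: ifPn => [/asboolP|]. Qed.

Let msetE Q : measurable Q -> mset Q = Q.
Proof. by move=> mQ; rewrite /mset asboolT. Qed.

Let bigcup_finite_sets (C : set (set T)) : finite_set C ->
  C `<=` measurable ->
  \bigcup_(Q in C) Q = \big[setU/set0]_(Q <- fset_set C) mset Q.
Proof.
move=> fC mC; rewrite -bigcup_fset_set//; apply: eq_bigcupr => Q CQ.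
by rewrite msetE//; exact: mC.
Qed.

Let trivIset_mset (C : set (set T)) : finite_set C -> C `<=` measurable ->
  trivIset C id -> trivIset [set` fset_set C] mset.
Proof.
move=> fC mC tC; rewrite fset_setK// => Q Q' CQ CQ'.
by rewrite !msetE; [exact: tC|exact: mC..].
Qed.

Lemma ge0_integral_partition (C : set (set T)) (g : T -> \bar R) :
  finite_set C -> C `<=` measurable -> trivIset C id ->
  measurable_fun (\bigcup_(Q in C) Q) g -> (forall x, 0 <= g x)%E ->
  (\int[mu]_(x in \bigcup_(Q in C) Q) g x =
   \sum_(Q <- fset_set C) \int[mu]_(x in Q) g x)%E.
Proof.
move=> fC mC tC; rewrite bigcup_finite_sets// => mg g0.
rewrite ge0_integral_bigsetU//; last exact: trivIset_mset.
apply: eq_big_seq => Q; rewrite in_fset_set// inE => CQ.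
by rewrite msetE//; exact: mC.
Qed.

Lemma integral_EFin_partition (C : set (set T)) (g : T -> R) :
  finite_set C -> C `<=` measurable -> trivIset C id ->
  measurable_fun (\bigcup_(Q in C) Q) (EFin \o g) ->
  (\int[mu]_(x in \bigcup_(Q in C) Q) (g x)%:E =
   \sum_(Q <- fset_set C) \int[mu]_(x in Q) (g x)%:E)%E.
Proof.
move=> fC mC tC; rewrite bigcup_finite_sets// => mg.
rewrite integral_bigsetU_EFin//; last exact: trivIset_mset.
apply: eq_big_seq => Q; rewrite in_fset_set// inE => CQ.
by rewrite msetE//; exact: mC.
Qed.

Lemma measure_partition (C : set (set T)) :
  finite_set C -> C `<=` measurable -> trivIset C id ->
  (mu (\bigcup_(Q in C) Q) = \sum_(Q <- fset_set C) mu Q)%E.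
Proof.
move=> fC mC tC; rewrite bigcup_finite_sets// measure_fbigsetU//; last exact: trivIset_mset.
apply: eq_big_seq => Q; rewrite in_fset_set// inE => CQ.
by rewrite msetE//; exact: mC.
Qed.

End partition_integral.

(* The cubes of one generation being disjoint, this union has a single member. *)
Definition cube {T : Type} (D : nat -> set (set T)) (n : nat) (x : T) : set T :=
  \bigcup_(Q in [set Q | D n Q /\ Q x]) Q.

(** Constancy on cubes stands in for measurability with respect to [F n]. With [U = Prop] it also
    applies to sets. *)
Definition adapted {T U : Type} (D : nat -> set (set T)) (n : nat) (g : T -> U) :=
  forall x y, cube D n x y -> g y = g x.

(** * Geometry of the cubes and consequences of homogeneity *)

Section cubes.
Context {d : measure_display} {T : measurableType d} {R : realType}.
Context {P : probability T R} {F D : nat -> set (set T)} {alpha : R}.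
Context (filtD : atomic_filtration F D).

Local Notation cube := (cube D).

Lemma cube_unique n Q x : D n Q -> Q x -> cube n x = Q.
Proof.
move=> DQ Qx; apply/seteqP; split=> [y [Q' [DQ' Q'x] Q'y]|y Qy]; last by exists Q.
have [_ [_ [_ [_ [_ /(_ n)[_ tD _ _]]]]]] := filtD.
by have <- : Q' = Q by apply: tD => //; exists x.
Qed.

Lemma cover_cubes n x : exists2 Q, D n Q & Q x.
Proof.
have [sF [_ [_ [_ [_ /(_ n)[_ _ _ FU]]]]]] := filtD.
have FT : F n setT.
  by have [F0 FC _] := sF n; rewrite -(setD0 setT); exact: FC.
have [C CD CE] := FU _ FT.
by have : [set: T] x by []; rewrite CE => -[Q CQ Qx]; exists Q => //; exact: CD.
Qed.

Lemma cube_in n x : D n (cube n x).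
Proof. by have [Q DQ Qx] := cover_cubes n x; rewrite (cube_unique _ _ _ DQ Qx). Qed.

Lemma cube_refl n x : cube n x x.
Proof. by have [Q DQ Qx] := cover_cubes n x; rewrite (cube_unique _ _ _ DQ Qx). Qed.

Lemma cube_eq n x y : cube n x y -> cube n y = cube n x.
Proof. by move=> xy; apply: cube_unique => //; exact: cube_in. Qed.

Lemma F_cube_sub n A x : F n A -> A x -> cube n x `<=` A.
Proof.
have [_ [_ [_ [_ [_ /(_ n)[_ _ _ FU]]]]]] := filtD.
move=> /FU[C CD ->] [Q CQ Qx]; rewrite (cube_unique _ _ _ (CD _ CQ) Qx).
by move=> y Qy; exists Q.
Qed.

Lemma F_cube n x : F n (cube n x).
Proof.
have [_ [_ [_ [_ [_ /(_ n)[_ _ DF _]]]]]] := filtD.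
by apply: DF; exact: cube_in.
Qed.

Lemma measurable_cube n x : measurable (cube n x).
Proof. by have [_ [Fm _]] := filtD; apply: (Fm n); exact: F_cube. Qed.

Lemma cubeS n x : cube n.+1 x `<=` cube n x.
Proof.
have [_ [_ [FS _]]] := filtD.
by apply: F_cube_sub (cube_refl n x); apply: FS; exact: F_cube.
Qed.

Lemma cube_le m n x : (m <= n)%N -> cube n x `<=` cube m x.
Proof.
elim: n => [|n IH]; first by rewrite leqn0 => /eqP->.
rewrite leq_eqVlt => /predU1P[->//|]; rewrite ltnS => mn.
by apply: subset_trans (IH mn); exact: cubeS.
Qed.

Lemma cube0 x : cube 0 x = setT.
Proof.
have [_ [_ [_ [F0 _]]]] := filtD.
have := F_cube 0 x; rewrite F0 => -[] // E.
by have := cube_refl 0 x; rewrite E.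
Qed.

Lemma adapted_le {U : Type} m n (g : T -> U) : (m <= n)%N ->
  adapted D m g -> adapted D n g.
Proof. by move=> mn gm x y xy; apply: gm; exact: cube_le xy. Qed.

Lemma trivIset_cubes n (A : set T) : trivIset (cube n @` A) id.
Proof.
have [_ [_ [_ [_ [_ /(_ n)[_ tD _ _]]]]]] := filtD.
by apply: sub_trivIset tD => _ [x _ <-]; exact: cube_in.
Qed.

Lemma measurable_cubes n (A : set T) : cube n @` A `<=` measurable.
Proof. by move=> _ [x _ <-]; exact: measurable_cube. Qed.

Lemma bigcup_cubes n (A : set T) : (forall x, A x -> cube n x `<=` A) ->
  \bigcup_(Q in cube n @` A) Q = A.
Proof.
move=> satA; apply/seteqP; split=> [y [_ [x Ax <-]]|x Ax]; first exact: satA.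
by exists (cube n x); [exists x|exact: cube_refl].
Qed.

Context (alpha_gt0 : 0 < alpha) (homD : homogeneous P D alpha).

(** Homogeneity is iterated from the single cube of generation 0. This makes all cubes of positive
    measure and each generation finite. *)
Lemma cube_measure_ge n x : ((alpha ^+ n)%:E <= P (cube n x))%E.
Proof.
elim: n => [|n IH]; first by rewrite cube0 probability_setT expr0.
have := homD n (cube n x) (cube n.+1 x) (cube_in n x).
move=> /(_ (conj (cube_in n.+1 x) (cubeS n x))); apply: le_trans.
by rewrite exprS EFinM lee_pmul2l.
Qed.

Lemma cube_measure_gt0 n x : (0 < P (cube n x))%E.
Proof. by apply: lt_le_trans (cube_measure_ge n x); rewrite lte_fin exprn_gt0. Qed.

(** More than [alpha ^- n] disjoint cubes of measure at least [alpha ^+ n] would have total measure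
    above 1. *)
Lemma finite_cubes n (A : set T) : finite_set (cube n @` A).
Proof.
apply: contrapT => /(infinite_set_fset (Num.trunc (alpha ^- n)).+1)[B BA Bsize].
have mB : [set` B] `<=` measurable by move=> Q /BA /measurable_cubes.
have tB : trivIset [set` B] id by apply: sub_trivIset (trivIset_cubes n A).
have fB : finite_set [set` B] by exact: finite_fset.
have : (P (\bigcup_(Q in [set` B]) Q) <= 1)%E.
  exact: probability_le1 (fin_bigcup_measurable fB mB).
rewrite measure_partition// set_fsetK.
apply/negP; rewrite -ltNge.
apply: (@lt_le_trans _ _ (\sum_(Q <- B) (alpha ^+ n)%:E)%E).
  rewrite sumEFin lte_fin big_const_seq count_predT iter_addr_0.
  rewrite -mulr_natl -ltr_pdivrMr ?exprn_gt0// mul1r.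
  apply: lt_le_trans (truncnS_gt _) _; rewrite ler_nat//.
rewrite big_seq [leRHS]big_seq; apply: lee_sum => Q /BA[x _ <-].
exact: cube_measure_ge.
Qed.

Lemma measurable_saturated n (A : set T) :
  (forall x, A x -> cube n x `<=` A) -> measurable A.
Proof.
move=> satA; rewrite -(bigcup_cubes _ _ satA).
apply: fin_bigcup_measurable; first exact: finite_cubes.
exact: measurable_cubes.
Qed.

Lemma measurable_adapted n (g : T -> R) : adapted D n g ->
  measurable_fun setT g.
Proof.
move=> gn _ B mB; rewrite setTI; apply: (measurable_saturated n) => x Bx y xy /=.
by rewrite /= (gn _ _ xy).
Qed.

End cubes.

(** * The martingale of averages and its square function *)

Definition mart {d : measure_display} {T : measurableType d} {R : realType}
    (P : probability T R) (D : nat -> set (set T)) (f : T -> R) (n : nat) : T -> R :=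
  fun x => avg P (cube D n x) f.

Definition sqsum {d : measure_display} {T : measurableType d} {R : realType}
    (P : probability T R) (D : nat -> set (set T)) (f : T -> R) (n : nat) : T -> R :=
  fun x => \sum_(k < n) (mart P D f k.+1 x - mart P D f k x) ^+ 2.

Section martingale.
Context {d : measure_display} {T : measurableType d} {R : realType}.
Context {P : probability T R} {F D : nat -> set (set T)} {alpha : R}.
Context (filtD : atomic_filtration F D).
Context (alpha_gt0 : 0 < alpha) (homD : homogeneous P D alpha).
Context (f : T -> R).

Local Notation cube := (cube D).
Local Notation f_ := (mart P D f).
Local Notation S_ := (sqsum P D f).

Lemma adapted_mart n : adapted D n (f_ n).
Proof. by move=> x y xy; rewrite /mart (cube_eq filtD _ _ _ xy). Qed.

Lemma adapted_sqsum n : adapted D n (S_ n).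
Proof.
move=> x y xy; apply: eq_bigr => -[k kn] _ /=.
rewrite (adapted_le filtD _ _ _ kn (adapted_mart k.+1) x y xy).
by rewrite (adapted_le filtD _ _ _ (ltnW kn) (adapted_mart k) x y xy).
Qed.

Lemma DeltaQ_cube n x : DeltaQ P D n (cube n x) f x = f_ n.+1 x - f_ n x.
Proof.
have EQ_cube k : EQ P (cube k x) f x = f_ k x.
  by rewrite /EQ indicE mem_set ?mulr1//; exact: cube_refl filtD _ _.
(* At [x] only the child [cube n.+1 x] contributes. *)
rewrite /DeltaQ EQ_cube -(fsbig_widen [set cube n.+1 x]).
- by rewrite fsbig_set1 EQ_cube.
- by move=> _ ->; split; [exact: cube_in filtD _ _|exact: cubeS filtD _ _].
- move=> Q [[DQ _] /= Qx]; rewrite /EQ indicE memNset ?mulr0// => xQ.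
  by apply: Qx; rewrite (cube_unique filtD _ _ _ DQ xQ).
Qed.

Lemma sqsum_le_Sfun n x : (sqrte (S_ n x)%:E <= Sfun P D f x)%E.
Proof.
have D2 (p : nat * set T) : (0 <= ((DeltaQ P D p.1 p.2 f x) ^+ 2)%:E)%E.
  by rewrite lee_fin sqr_ge0.
rewrite /Sfun lee_sqrt; last by apply: esum_ge0 => p _; exact: D2.
(* Pairing with the generation keeps the map injective even when a cube is its own child. *)
apply: esum_ge; exists ((fun k => (k, cube k x)) @` `I_n).
  split; first exact: finite_image.
  by move=> _ [k _ <-]/=; exact: cube_in filtD _ _.
rewrite fsbig_image/=; last by move=> i j _ _ [].
rewrite -(fsbig_ord _ n (fun k => ((DeltaQ P D k (cube k x) f x) ^+ 2)%:E)).
rewrite sumEFin lee_fin; apply: ler_sum => k _.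
by rewrite DeltaQ_cube.
Qed.

(* Every cube has positive measure, so a bound holding almost everywhere holds
   at every point for the partial sums. *)
Lemma sqsum_le_ess_sup n x : (ess_sup P (Sfun P D f) < +oo)%E ->
  S_ n x <= fine (ess_sup P (Sfun P D f)) ^+ 2.
Proof.
move=> supf; have [N [mN PN0 SN]] := ess_sup_ge P (Sfun P D f).
have [y xy Ny] : exists2 y, cube n x y & ~ N y.
  apply: contrapT => noy; have cN : cube n x `<=` N.
    by move=> y xy; apply: contrapT => Ny; apply: noy; exists y.
  have := cube_measure_gt0 filtD alpha_gt0 homD n x.
  rewrite ltNge => /negP; apply; rewrite -PN0.
  by rewrite le_measure ?inE//; exact: measurable_cube filtD _ _.
have Sy : (Sfun P D f y <= ess_sup P (Sfun P D f))%E.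
  by apply: contrapT => nSy; apply: Ny; exact: SN.
rewrite -(adapted_sqsum n x y xy).
have := le_trans (sqsum_le_Sfun n y) Sy.
have : (0 <= ess_sup P (Sfun P D f))%E by apply: le_trans Sy; exact: sqrte_ge0.
have sy0 : 0 <= S_ n y by apply: sumr_ge0 => k _; exact: sqr_ge0.
case: (ess_sup P (Sfun P D f)) supf => // s _; rewrite !lee_fin/= => s0 ss.
by rewrite -[leLHS]sqr_sqrtr// ler_sqr// nnegrE// sqrtr_ge0.
Qed.

Lemma integral_adapted_cube n (h : T -> R) x : adapted D n h ->
  (\int[P]_(y in cube n x) (h y)%:E = (h x)%:E * P (cube n x))%E.
Proof.
move=> hn; rewrite (eq_integral (cst (h x)%:E)); last first.
  by move=> y; rewrite inE => /hn ->.
by rewrite integral_cst//; exact: measurable_cube filtD _ _.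
Qed.

Lemma le_integral_cubes n (g h : T -> \bar R) :
  measurable_fun setT g -> (forall x, 0 <= g x)%E ->
  measurable_fun setT h -> (forall x, 0 <= h x)%E ->
  (forall x, \int[P]_(y in cube n x) g y <= \int[P]_(y in cube n x) h y)%E ->
  (\int[P]_y g y <= \int[P]_y h y)%E.
Proof.
move=> mg g0 mh h0 gh.
have UT : \bigcup_(Q in range (cube n)) Q = [set: T] by exact: bigcup_cubes filtD _ _ _.
have fin : finite_set (range (cube n)) by exact: finite_cubes filtD alpha_gt0 homD _ _.
have mC := measurable_cubes filtD n setT.
have tC := trivIset_cubes filtD n setT.
rewrite -UT !ge0_integral_partition ?UT//.
rewrite big_seq [leRHS]big_seq; apply: lee_sum => Q.
by rewrite in_fset_set// inE => -[x _ <-].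
Qed.

Context (intf : P.-integrable setT (EFin \o f)).

Let intf_cube n x : P.-integrable (cube n x) (EFin \o f).
Proof. by apply: integrableS intf => //; exact: measurable_cube filtD _ _. Qed.

Lemma fine_cube_gt0 n x : 0 < fine (P (cube n x)).
Proof.
rewrite fine_gt0// (cube_measure_gt0 filtD alpha_gt0 homD)/= ltey_eq.
by rewrite fin_num_measure//; exact: measurable_cube filtD _ _.
Qed.

Lemma mart_mul_measure n x :
  f_ n x * fine (P (cube n x)) = fine (\int[P]_(y in cube n x) (f y)%:E).
Proof. by rewrite /mart /avg divfK// gt_eqF// fine_cube_gt0. Qed.

(** On the cube [f_ n - h] is constant and equal to the average of [f - h], so this is the triangle
    inequality for the integral. *)
Lemma integral_mart_cube_le n (h : T -> R) x : adapted D n h ->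
  P.-integrable setT (EFin \o h) ->
  (\int[P]_(y in cube n x) `|f_ n y - h y|%:E <=
   \int[P]_(y in cube n x) `|f y - h y|%:E)%E.
Proof.
move=> hn inth.
have mQ : measurable (cube n x) by exact: measurable_cube filtD _ _.
rewrite (integral_adapted_cube n (fun y => `|f_ n y - h y|)); last first.
  by move=> u v uv; rewrite (hn _ _ uv) (adapted_mart n _ _ uv).
have inth' : P.-integrable (cube n x) (EFin \o h) by apply: integrableS inth.
have intfh : P.-integrable (cube n x) (fun y => (f y - h y)%:E).
  by apply: eq_integrable (integrableB mQ (intf_cube n x) inth').
apply: le_trans (le_abse_integral P mQ (measurable_int _ intfh)).
have PQ : P (cube n x) \is a fin_num by rewrite fin_num_measure.
rewrite -[X in (_ * X)%E](fineK PQ).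
rewrite (_ : (\int[P]_(y in cube n x) (f y - h y)%:E)%E =
   ((f_ n x - h x) * fine (P (cube n x)))%:E).
  by rewrite abse_EFin normrM lee_fin (ger0_norm (ltW (fine_cube_gt0 n x))).
under eq_integral do rewrite EFinB.
rewrite integralB_EFin//; try exact: (intf_cube n x).
rewrite (integral_adapted_cube n h x hn) mulrBl mart_mul_measure EFinB fineK.
  by rewrite EFinM fineK.
exact: integrable_fin_num.
Qed.

Lemma integral_mart_le n (h : T -> R) : adapted D n h ->
  P.-integrable setT (EFin \o h) ->
  (\int[P]_y `|f_ n y - h y|%:E <= \int[P]_y `|f y - h y|%:E)%E.
Proof.
move=> hn inth.
have mm : measurable_fun setT (f_ n).
  exact: measurable_adapted filtD alpha_gt0 homD _ _ (adapted_mart n).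
have mh : measurable_fun setT h by apply/measurable_EFinP; exact: measurable_int inth.
have mf : measurable_fun setT f by apply/measurable_EFinP; exact: measurable_int intf.
apply: (le_integral_cubes n) => //.
- by apply/measurable_EFinP; apply: measurableT_comp => //; exact: measurable_funB.
- by apply/measurable_EFinP; apply: measurableT_comp => //; exact: measurable_funB.
- by move=> x; exact: integral_mart_cube_le.
Qed.

End martingale.

(** * The exponential supermartingale *)

Section supermartingale.
Context {d : measure_display} {T : measurableType d} {R : realType}.
Context {P : probability T R} {F D : nat -> set (set T)} {alpha : R}.
Context (filtD : atomic_filtration F D).
Context (alpha_gt0 : 0 < alpha) (alpha_le : alpha <= 2^-1).
Context (homD : homogeneous P D alpha).
Context (f : T -> R) (intf : P.-integrable setT (EFin \o f)).

Local Notation cube := (cube D).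
Local Notation f_ := (mart P D f).
Local Notation S_ := (sqsum P D f).

Let Z n x := expR (f_ n x - S_ n x / (4 * alpha)).

Let adapted_Z n : adapted D n (Z n).
Proof.
move=> x y xy; rewrite /Z (adapted_mart filtD f n _ _ xy).
by rewrite (adapted_sqsum filtD f n _ _ xy).
Qed.

Let measurable_Z n : measurable_fun setT (EFin \o Z n).
Proof.
apply/measurable_EFinP.
exact: measurable_adapted filtD alpha_gt0 homD _ _ (adapted_Z n).
Qed.

(** An instance of [sum_expR_sub_sqr_le1]: the weights [P A / P Q] are at least [alpha] by
    homogeneity, and the increments are centred because the integrals of [f] over the children add
    up to that over [Q]. *)
Lemma cube_children_le1 n x (Q := cube n x) :
  \sum_(A <- fset_set (cube n.+1 @` Q)) fine (P A) / fine (P Q) *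
    expR ((avg P A f - avg P Q f) - (avg P A f - avg P Q f) ^+ 2 / (4 * alpha)) <= 1.
Proof.
have mQ : measurable Q by exact: measurable_cube filtD _ _.
have satQ y : Q y -> cube n.+1 y `<=` Q.
  by move=> Qy; rewrite /Q -(cube_eq filtD _ _ _ Qy); exact: cubeS filtD _ _.
have UQ : \bigcup_(A in cube n.+1 @` Q) A = Q by exact: bigcup_cubes filtD _ _ satQ.
have fC : finite_set (cube n.+1 @` Q) by exact: finite_cubes filtD alpha_gt0 homD _ _.
have mC := measurable_cubes filtD n.+1 Q.
have tC := trivIset_cubes filtD n.+1 Q.
have PQ0 : 0 < fine (P Q) by exact: fine_cube_gt0 filtD alpha_gt0 homD _ _.
have PQf : P Q \is a fin_num by rewrite fin_num_measure.
have inC A : A \in fset_set (cube n.+1 @` Q) -> exists2 y, Q y & cube n.+1 y = A.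
  by rewrite in_fset_set// inE.
have P1 : \sum_(A <- fset_set (cube n.+1 @` Q)) fine (P A) = fine (P Q).
  apply: EFin_inj; rewrite -sumEFin fineK// -[in RHS]UQ measure_partition//.
  apply: eq_big_seq => A /inC[y _ <-].
  by rewrite fineK// fin_num_measure//; exact: measurable_cube filtD _ _.
have P1' : \sum_(A <- fset_set (cube n.+1 @` Q)) fine (P A) / fine (P Q) = 1.
  by rewrite -mulr_suml P1 divff// gt_eqF.
have If : \sum_(A <- fset_set (cube n.+1 @` Q)) fine (P A) * avg P A f =
    fine (\int[P]_(y in Q) (f y)%:E).
  have intA A : measurable A -> P.-integrable A (EFin \o f).
    by move=> mA; apply: integrableS intf.
  apply: EFin_inj; rewrite -sumEFin fineK; last exact: integrable_fin_num (intA _ mQ).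
  rewrite -[in RHS]UQ integral_EFin_partition//; last first.
    by rewrite UQ; exact: measurable_int (intA _ mQ).
  apply: eq_big_seq => A /inC[y _ <-]; rewrite mulrC.
  rewrite -[avg _ _ _]/(f_ n.+1 y) (mart_mul_measure filtD alpha_gt0 homD).
  have mA := measurable_cube filtD n.+1 y.
  by rewrite fineK//; exact: integrable_fin_num (intA _ mA).
apply: (@sum_expR_sub_sqr_le1 R (set T)) => //.
- exact: fset_uniq.
- move=> A /inC[y Qy <-]; rewrite ler_pdivlMr//.
  have mA := measurable_cube filtD n.+1 y.
  rewrite -lee_fin EFinM !fineK ?fin_num_measure//.
  apply: homD; first exact: cube_in filtD _ _.
  by split; [exact: cube_in filtD _ _|exact: satQ].
- rewrite (eq_bigr (fun A => fine (P A) * avg P A f / fine (P Q) -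
     fine (P A) / fine (P Q) * avg P Q f)); last by move=> A _; ring.
  rewrite big_split/= sumrN -[X in X - _]mulr_suml -[X in _ - X]mulr_suml P1' If mul1r.
  by rewrite /avg subrr.
Qed.

(** On each child [Z n.+1] is the constant [Z n x] times the exponential in [cube_children_le1]. *)
Let supermart_cube n x :
  (\int[P]_(y in cube n x) (Z n.+1 y)%:E <= \int[P]_(y in cube n x) (Z n y)%:E)%E.
Proof.
set Q := cube n x.
have mQ : measurable Q by exact: measurable_cube filtD _ _.
have satQ y : Q y -> cube n.+1 y `<=` Q.
  by move=> Qy; rewrite /Q -(cube_eq filtD _ _ _ Qy); exact: cubeS filtD _ _.
have UQ : \bigcup_(A in cube n.+1 @` Q) A = Q by exact: bigcup_cubes filtD _ _ satQ.
have fC : finite_set (cube n.+1 @` Q) by exact: finite_cubes filtD alpha_gt0 homD _ _.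
have mC := measurable_cubes filtD n.+1 Q.
have tC := trivIset_cubes filtD n.+1 Q.
have PQ0 : 0 < fine (P Q) by exact: fine_cube_gt0 filtD alpha_gt0 homD _ _.
have PQf : P Q \is a fin_num by rewrite fin_num_measure.
rewrite [leRHS](integral_adapted_cube filtD n (Z n) x (adapted_Z n)) -/Q.
rewrite -[in leLHS]UQ ge0_integral_partition//; last 2 first.
- by apply: measurable_funS (measurable_Z n.+1) => //; rewrite UQ.
- by move=> y; rewrite lee_fin expR_ge0.
rewrite (eq_big_seq (fun A => (Z n x * fine (P Q) * (fine (P A) / fine (P Q) *
    expR ((avg P A f - avg P Q f) - (avg P A f - avg P Q f) ^+ 2 / (4 * alpha))))%:E)).
  rewrite sumEFin -mulr_sumr -[X in (_ <= _ * X)%E](fineK PQf) -EFinM lee_fin.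
  rewrite ler_piMr//; first by rewrite mulr_ge0 ?expR_ge0// ltW.
  exact: cube_children_le1.
move=> A; rewrite in_fset_set// inE => -[y Qy <-].
rewrite (integral_adapted_cube filtD n.+1 (Z n.+1) y (adapted_Z n.+1)).
have mA := measurable_cube filtD n.+1 y.
have PA : P (cube n.+1 y) \is a fin_num by rewrite fin_num_measure.
rewrite -[X in (_ * X)%E](fineK PA) -EFinM; congr EFin.
rewrite -(adapted_Z n x y Qy).
have -> : avg P Q f = f_ n y by rewrite (adapted_mart filtD f n x y Qy).
have -> : Z n.+1 y = Z n y *
  expR (f_ n.+1 y - f_ n y - (f_ n.+1 y - f_ n y) ^+ 2 / (4 * alpha)).
  rewrite /Z -expRD; congr expR.
  by rewrite /sqsum big_ord_recr/=; ring.
rewrite -/(f_ n.+1 y).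
by field; rewrite gt_eqF.
Qed.

Lemma integral_supermart n : (\int[P]_y (Z n y)%:E <=
  (expR (fine (\int[P]_y (f y)%:E)))%:E)%E.
Proof.
elim: n => [|n]; last first.
  apply: le_trans; apply: (le_integral_cubes filtD alpha_gt0 homD n) => //;
    try exact: measurable_Z.
  - by move=> x; rewrite lee_fin expR_ge0.
  - by move=> x; rewrite lee_fin expR_ge0.
(* In generation 0 the only cube is the whole space and the square sum is empty, so [Z 0] is
   constant. *)
rewrite (eq_integral (cst (expR (fine (\int[P]_y (f y)%:E)))%:E)).
  by rewrite integral_cst// [X in (_ * X)%E]probability_setT mule1.
move=> x _; rewrite /Z /sqsum big_ord0 mul0r subr0 /mart (cube0 filtD) /avg.
have -> : fine (P [set: T]) = 1 by rewrite probability_setT.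
by rewrite divr1.
Qed.

(** The bound on [S_ n] holds at every point, so [expR (f_ n - e)] is at most
    [expR (s ^+ 2 / (4 * alpha) - e)] times [Z n]. *)
Lemma integral_expR_mart_le n : (ess_sup P (Sfun P D f) < +oo)%E ->
  (\int[P]_y (expR (f_ n y - fine (\int[P]_z (f z)%:E)))%:E <=
   (expR (fine (ess_sup P (Sfun P D f)) ^+ 2 / (4 * alpha)))%:E)%E.
Proof.
move=> supf; set e := fine _; set s := fine _.
apply: (@le_trans _ _ (\int[P]_y ((expR (s ^+ 2 / (4 * alpha) - e))%:E * (Z n y)%:E))%E).
  apply: ge0_le_integral => //.
  - apply/measurable_EFinP; apply: (measurable_adapted filtD alpha_gt0 homD n) => x y xy.
    by rewrite (adapted_mart filtD f n x y xy).
  - by apply: measurable_funeM; exact: measurable_Z.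
  - move=> y _; rewrite -EFinM lee_fin -expRD ler_expR.
    have : S_ n y / (4 * alpha) <= s ^+ 2 / (4 * alpha).
      rewrite ler_pM2r ?invr_gt0 ?mulr_gt0//.
      exact: sqsum_le_ess_sup filtD alpha_gt0 homD _ _ _ supf.
    by lra.
rewrite ge0_integralZl_EFin ?expR_ge0//; last 2 first.
- by move=> y _; rewrite lee_fin expR_ge0.
- exact: measurable_Z.
apply: (@le_trans _ _ ((expR (s ^+ 2 / (4 * alpha) - e))%:E * (expR e)%:E)%E).
  by rewrite lee_pmul2l ?lte_fin ?expR_gt0//; exact: integral_supermart.
by rewrite -EFinM -expRD lee_fin ler_expR; lra.
Qed.
End supermartingale.

(** * Density of adapted functions in [L^1] *)

Definition L1_approximable {d : measure_display} {T : measurableType d}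
    {R : realType} (P : probability T R) (D : nat -> set (set T)) (h : T -> R) :=
  measurable_fun setT h /\ forall e, 0 < e -> exists n (g : T -> R),
    adapted D n g /\ (\int[P]_x `|h x - g x|%:E <= e%:E)%E.

Import HBSimple.

Section density.
Context {d : measure_display} {T : measurableType d} {R : realType}.
Context {P : probability T R} {F D : nat -> set (set T)} {alpha : R}.
Context (filtD : atomic_filtration F D).
Context (alpha_gt0 : 0 < alpha) (homD : homogeneous P D alpha).

Local Notation cube := (cube D).
Local Notation approx := (L1_approximable P D).

Lemma integral_norm_triangle (u v w : T -> R) :
  measurable_fun setT u -> measurable_fun setT v -> measurable_fun setT w ->
  (\int[P]_x `|u x - w x|%:E <=
   \int[P]_x `|u x - v x|%:E + \int[P]_x `|v x - w x|%:E)%E.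
Proof.
move=> mu mv mw.
have mB (a b : T -> R) : measurable_fun setT a -> measurable_fun setT b ->
    measurable_fun setT (fun x => `|a x - b x|%:E).
  move=> ma mb; apply/measurable_EFinP; apply: measurableT_comp => //.
  exact: measurable_funB.
rewrite -ge0_integralD//; try exact: mB.
apply: ge0_le_integral => //; first exact: mB.
  by apply: emeasurable_funD; exact: mB.
by move=> x _; rewrite -EFinD lee_fin ler_distD.
Qed.

Let measurable_ad n (g : T -> R) : adapted D n g -> measurable_fun setT g.
Proof. exact: measurable_adapted filtD alpha_gt0 homD n g. Qed.

Lemma approximable_adapted n (g : T -> R) : adapted D n g -> approx g.
Proof.
move=> gn; split; first exact: measurable_ad gn.
move=> e e0; exists n, g; split=> //.
rewrite (eq_integral (cst 0%E)) ?integral0 ?lee_fin ?ltW//.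
by move=> x _; rewrite subrr normr0.
Qed.

Lemma approximable_lim (h : T -> R) : measurable_fun setT h ->
  (forall e, 0 < e ->
    exists2 h', approx h' & (\int[P]_x `|h x - h' x|%:E <= e%:E)%E) ->
  approx h.
Proof.
move=> mh H; split=> // e e0.
have e2 : 0 < e / 2 by rewrite divr_gt0.
have [h' [mh' /(_ _ e2)[n [g [gn h'g]]]] hh'] := H _ e2.
exists n, g; split=> //.
apply: le_trans (integral_norm_triangle h h' g mh mh' (measurable_ad n g gn)) _.
by rewrite [e]splitr EFinD leeD.
Qed.

Lemma approximableB (h k : T -> R) : approx h -> approx k ->
  approx (fun x => h x - k x).
Proof.
move=> [mh H] [mk K]; split; first exact: measurable_funB.
move=> e e0; have e2 : 0 < e / 2 by rewrite divr_gt0.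
have [n [g [gn hg]]] := H _ e2; have [n' [g' [gn' kg']]] := K _ e2.
have gm := adapted_le filtD _ _ _ (leq_maxl n n') gn.
have gm' := adapted_le filtD _ _ _ (leq_maxr n n') gn'.
exists (maxn n n'), (fun x => g x - g' x); split.
  by move=> x y xy; rewrite (gm x y xy) (gm' x y xy).
have mg := measurable_ad _ g gm; have mg' := measurable_ad _ g' gm'.
rewrite [e]splitr EFinD.
apply: le_trans (leeD hg kg').
have mB (a b : T -> R) : measurable_fun setT a -> measurable_fun setT b ->
    measurable_fun setT (fun x => `|a x - b x|%:E).
  move=> ma mb; apply/measurable_EFinP; apply: measurableT_comp => //.
  exact: measurable_funB.
rewrite -ge0_integralD//; try exact: mB.
apply: ge0_le_integral => //.
- by apply: mB; exact: measurable_funB.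
- by apply: emeasurable_funD; exact: mB.
move=> x _; rewrite -EFinD lee_fin.
rewrite (_ : _ - _ - _ = (h x - g x) - (k x - g' x)); last ring.
exact: ler_normB.
Qed.

Lemma approximableZ (c : R) (h : T -> R) : approx h -> approx (fun x => c * h x).
Proof.
move=> [mh H]; split; first exact: measurable_funM.
move=> e e0.
have c1 : 0 < `|c| + 1 by rewrite ltr_wpDl.
have [n [g [gn hg]]] := H (e / (`|c| + 1)) (divr_gt0 e0 c1).
exists n, (fun x => c * g x); split; first by move=> x y xy; rewrite (gn x y xy).
have mhg : measurable_fun setT (fun x => `|h x - g x|%:E).
  apply/measurable_EFinP; apply: measurableT_comp => //.
  by apply: measurable_funB => //; exact: measurable_ad gn.
rewrite (eq_integral (fun x => `|c|%:E * `|h x - g x|%:E)%E); last first.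
  by move=> x _; rewrite -mulrBr normrM EFinM.
rewrite ge0_integralZl_EFin//.
apply: (@le_trans _ _ (`|c|%:E * (e / (`|c| + 1))%:E)%E).
  by rewrite lee_wpmul2l// lee_fin.
rewrite -EFinM lee_fin mulrCA ger_pMr// ler_pdivrMr// mul1r.
by lra.
Qed.

Lemma approximable_sum (I : Type) (r : seq I) (h : I -> T -> R) :
  (forall i, approx (h i)) -> approx (fun x => \sum_(i <- r) h i x).
Proof.
move=> ah; elim: r => [|i r IH].
  by apply: (approximable_adapted 0) => x y _; rewrite !big_nil.
have -> : (fun x => \sum_(j <- i :: r) h j x) =
    (fun x => h i x - (-1) * (\sum_(j <- r) h j x)).
  by apply/funext => x; rewrite big_cons; ring.
by apply: approximableB => //; exact: approximableZ.
Qed.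

Let approx_sets := [set A | measurable A /\ approx (\1_A : T -> R)].

(** Proper differences are handled by [approximableB], increasing unions by continuity of [P] from
    below together with [approximable_lim]. *)
Let lambda_system_approx : lambda_system setT approx_sets.
Proof.
split.
- by [].
- split=> //; apply: (approximable_adapted 0) => x y _.
  by rewrite !indicE !mem_set.
- move=> A B BA [mA aA] [mB aB]; split; first exact: measurableD.
  have -> : \1_(A `\` B) = (fun x => \1_A x - \1_B x) :> (T -> R).
    apply/funext => x; rewrite !indicE in_setD.
    have [xB|xB] /= := boolP (x \in B).
      by rewrite (mem_set (BA _ (set_mem xB))) subrr.
    by rewrite andbT subr0.
  exact: approximableB.
- move=> A ndA aA.
  have mA k : measurable (A k) by have [] := aA k.
  have mU : measurable (\bigcup_k A k) by exact: bigcup_measurable.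
  split=> //; apply: approximable_lim; first exact: measurable_indic.
  move=> e e0.
  have PU : P (\bigcup_k A k) \is a fin_num by rewrite fin_num_measure.
  have lt : (P (\bigcup_k A k) - e%:E < P (\bigcup_k A k))%E.
    by rewrite lteBlDr// lteDl// lte_fin.
  have [k _ /(_ k (leqnn k))/= Hk] :=
    nondecreasing_cvg_mu mA mU ndA (open_ereal_gt' lt).
  exists (\1_(A k)); first by have [] := aA k.
  have AU : A k `<=` \bigcup_k A k by exact: bigcup_sup.
  rewrite (eq_integral (fun x => (\1_((\bigcup_k A k) `\` A k) x)%:E)).
    rewrite integral_indic//; last exact: measurableD.
    rewrite setIT measureD//; last by rewrite -ge0_fin_numE.
    rewrite setIidr// leeBlDr ?fin_num_measure//.
    by rewrite addeC -leeBlDr// ltW.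
  move=> x _; congr EFin; rewrite !indicE in_setD.
  have [xA|xA] /= := boolP (x \in A k).
    by rewrite (mem_set (AU _ (set_mem xA))) subrr normr0 ?mulr0.
  by rewrite andbT subr0 ger0_norm.
Qed.

(** Monotone class argument: the sets adapted to some generation are stable under intersection,
    since two generations have a common refinement, and they generate all measurable sets. *)
Lemma approximable_indic (A : set T) : measurable A -> approx (\1_A : T -> R).
Proof.
move=> mA.
pose G := [set B : set T | exists n, adapted D n B].
suff sub : <<s G >> `<=` approx_sets.
  have [_ [_ [_ [_ [mE _]]]]] := filtD.
  have := mA; rewrite mE => /(_ _)-/= sA.
  have [] // := sub A _.
  apply: (sub_sigma_algebra2 _ sA) => B [n _ FB]; exists n => x y xy.
  apply/propext; split=> [By|Bx]; last exact: (F_cube_sub filtD _ _ _ FB Bx).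
  apply: (F_cube_sub filtD _ _ _ FB By).
  by rewrite (cube_eq filtD _ _ _ xy); exact: cube_refl filtD _ _.
apply: lambda_system_subset => //.
- move=> B C [n Bn] [m Cm]; exists (maxn n m).
  have Bnm := adapted_le filtD _ _ _ (leq_maxl n m) Bn.
  have Cnm := adapted_le filtD _ _ _ (leq_maxr n m) Cm.
  by move=> x y xy; rewrite /setI /mkset/= (Bnm x y xy) (Cnm x y xy).
- move=> B [n Bn]; split.
    apply: (measurable_saturated filtD alpha_gt0 homD n) => x Bx y xy.
    by rewrite (Bn x y xy).
  apply: (approximable_adapted n) => x y xy.
  rewrite !indicE; congr (nat_of_bool _)%:R.
  by apply/idP/idP; rewrite !inE (Bn x y xy).
Qed.

(** Integrable functions are [L^1] limits of simple functions, which are finite combinations of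
    indicators. *)
Lemma approximable_integrable (f : T -> R) :
  P.-integrable setT (EFin \o f) -> approx f.
Proof.
move=> intf.
have [g [_ _ gf]] := approximation_sfun_integrable measurableT intf.
apply: approximable_lim; first by apply/measurable_EFinP; exact: measurable_int intf.
move=> e e0.
have lt : (0 < e%:E)%E by rewrite lte_fin.
have [k _ /(_ k (leqnn k))/= Hk] := gf _ (open_ereal_lt' lt).
exists (g k); last exact: ltW.
rewrite (_ : (g k : T -> R) = fun x =>
  \sum_(y <- fset_set (range (g k))) y * \1_(g k @^-1` [set y]) x).
  apply: approximable_sum => y; apply: approximableZ; apply: approximable_indic.
  exact: measurable_sfunP.
apply/funext => x; rewrite fimfunE fsbig_finite//.
Qed.

(** If an adapted [g] is within [e / 2] of [f], then so is it of [mart P D f n], because averaging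
    over the cubes fixes [g] and contracts the [L^1] distance. *)
Lemma mart_cvg_L1 (f : T -> R) e : P.-integrable setT (EFin \o f) -> 0 < e ->
  exists n, (\int[P]_x `|mart P D f n x - f x|%:E <= e%:E)%E.
Proof.
move=> intf e0; have e2 : 0 < e / 2 by rewrite divr_gt0.
have [mf /(_ _ e2)[n [g [gn fg]]]] := approximable_integrable f intf.
have mg := measurable_ad n g gn.
have intg : P.-integrable setT (EFin \o g).
  apply/integrableP; split; first exact/measurable_EFinP.
  (* Comparison with the zero function through [f] bounds the norm of [g]. *)
  have := integral_norm_triangle g f (cst 0) mg mf (measurable_cst _).
  under eq_integral do rewrite subr0.
  move=> /le_lt_trans; apply.
  apply: lte_add_pinfty.
    under eq_integral do rewrite distrC.
    exact: le_lt_trans fg (ltry _).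
  under eq_integral do rewrite subr0.
  by have /integrableP[] := intf.
exists n; have mm := measurable_ad n (mart P D f n) (adapted_mart filtD f n).
apply: (le_trans (integral_norm_triangle (mart P D f n) g f mm mg mf)).
rewrite [e]splitr EFinD leeD//.
  exact: le_trans (integral_mart_le filtD alpha_gt0 homD f intf n g gn intg) fg.
by under eq_integral do rewrite distrC.
Qed.

End density.

(** * Passage from the averages to [f] *)

Theorem theorem2p2 (d : measure_display) (T : measurableType d) (R : realType)
  (P : probability T R) (F D : nat -> set (set T)) (alpha : R) (f : T -> R) :
  atomic_filtration F D ->
  0 < alpha -> alpha <= 2^-1 ->
  homogeneous P D alpha ->
  P.-integrable setT (EFin \o f) ->
  (ess_sup P (Sfun P D f) < +oo)%E ->
  (\int[P]_x (expR (f x - fine (\int[P]_y (f y)%:E)))%:E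
    <= (expR ((fine (ess_sup P (Sfun P D f))) ^+ 2 / (4 * alpha)))%:E)%E.
Proof.
move=> filtD alpha_gt0 alpha_le homD intf supf.
have mf : measurable_fun setT f by apply/measurable_EFinP; exact: measurable_int intf.
set E := fine (\int[P]_y (f y)%:E).
set C := expR _.
(* Truncating the exponent at [N] bounds the slope of [expR] by [expR N%:R], which makes an [L^1]
   error in [f] harmless. *)
pose g (N : nat) x := (expR (Num.min (f x - E) N%:R))%:E.
have mg N : measurable_fun setT (g N).
  apply/measurable_EFinP; apply: measurableT_comp => //.
  by apply: measurable_minr => //; exact: measurable_funB.
have gC N : (\int[P]_x g N x <= C%:E)%E.
  apply/lee_addgt0Pr => e e0.
  (* The precision [e / expR N%:R] compensates the factor [expR N%:R] from convexity. *)
  have [n Hn] := mart_cvg_L1 filtD alpha_gt0 homD f (e / expR N%:R) intf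
    (divr_gt0 e0 (expR_gt0 _)).
  have mm : measurable_fun setT (mart P D f n).
    exact: measurable_adapted filtD alpha_gt0 homD n _ (adapted_mart filtD f n).
  have mm1 : measurable_fun setT (fun x => (expR (mart P D f n x - E))%:E).
    apply/measurable_EFinP; apply: measurableT_comp => //.
    exact: measurable_funB.
  have mm2 : measurable_fun setT (fun x => `|mart P D f n x - f x|%:E).
    apply/measurable_EFinP; apply: measurableT_comp => //.
    exact: measurable_funB.
  apply: (@le_trans _ _ (\int[P]_x ((expR (mart P D f n x - E))%:E +
      (expR N%:R)%:E * `|mart P D f n x - f x|%:E))%E).
    apply: ge0_le_integral => //.
    - by move=> x _; rewrite lee_fin expR_ge0.
    - by apply: emeasurable_funD => //; exact: measurable_funeM.
    - move=> x _; rewrite -EFinM -EFinD lee_fin.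
      set v := Num.min _ _; set w := mart P D f n x.
      (* Convexity of [expR]: [expR (w - E) >= expR v * (1 + (w - E - v))]. *)
      have vf : v <= f x - E by rewrite ge_min lexx.
      have vN : expR v <= expR N%:R by rewrite ler_expR ge_min lexx orbT.
      have H1 := expR_ge1Dx (w - E - v).
      have : expR v * (1 + (w - E - v)) <= expR (w - E).
        by rewrite -[leRHS](_ : expR v * expR (w - E - v) = _)
          ?ler_pM2l ?expR_gt0// -expRD; congr expR; ring.
      have : expR v * `|w - f x| <= expR N%:R * `|w - f x| by rewrite ler_wpM2r.
      have : expR v * (- `|w - f x|) <= expR v * (w - E - v).
        rewrite ler_pM2l ?expR_gt0//.
        have := ler_norm (- (w - f x)); rewrite normrN.
        by lra.
      by lra.
  rewrite ge0_integralD//; last exact: measurable_funeM.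
  rewrite ge0_integralZl_EFin ?expR_ge0// leeD//.
    exact: integral_expR_mart_le filtD alpha_gt0 alpha_le homD f intf n supf.
  apply: (@le_trans _ _ ((expR N%:R)%:E * (e / expR N%:R)%:E)%E).
    by rewrite lee_pmul2l ?lte_fin ?expR_gt0.
  by rewrite -EFinM lee_fin mulrC divfK// gt_eqF// expR_gt0.
have ndg x : {homo g ^~ x : n m / (n <= m)%N >-> (n <= m)%E}.
  move=> n m nm; rewrite lee_fin ler_expR le_min ge_min lexx/= ge_min.
  by rewrite ler_nat nm orbT.
have g0 N x : [set: T] x -> (0 <= g N x)%E by rewrite lee_fin expR_ge0.
(* Monotone convergence in [N]: at each point the truncation is inactive for [N] large. *)
have := @cvg_monotone_convergence _ _ _ P _ measurableT _ mg g0 (fun x _ => ndg x).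
rewrite (eq_integral (fun x => (expR (f x - E))%:E)); last first.
  move=> x _; apply: cvg_lim => //; apply: cvg_near_cst.
  near=> N; congr (EFin (expR _)); apply/min_idPl.
  near: N; exact: nbhs_infty_ger.
move=> cv; rewrite -(cvg_lim _ cv)//.
by apply: lime_le; [apply/cvg_ex; eexists; exact: cv|exact: nearW].
Unshelve. all: by end_near.
Qed.
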